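(* Let $k$ be a positive integer and let $S_1$ and $S_2$ be two submonoids of $\mathcal{U}_k$ that contain $\mathfrak{S}_k$. Then $S_1\cup S_2$ is also a submonoid of $\mathcal{U}_k$. (Consequently, the submonoids of $\mathcal{U}_k$ containing $\mathfrak{S}_k$ form a distributive lattice under union and intersection.)
   Context: Let $[k]=\{1,\dots,k\}$, $[\bar k]=\{\bar 1,\dots,\bar k\}$. $\mathcal{U}_k$ (the uniform block permutation monoid) is the set of set partitions of $[k]\cup[\bar k]$ all of whose blocks $A$ satisfy $|A\cap[k]|=|A\cap[\bar k]|$, with product given by diagram concatenation: for $\pi,\gamma\in\mathcal{U}_k$, place $\pi$ on $[k]\cup M$ (renaming $\bar i$ to $i'$) and $\gamma$ on $M\cup[\bar k]$ (renaming $i$ to $i'$), $M=\{1',\dots,k'\}$, take the join (connected components) of these two set partitions of $[k]\cup M\cup[\bar k]$, and restrict to $[k]\cup[\bar k]$. The symmetric group $\mathfrak{S}_k$ is embedded in $\mathcal{U}_k$ via $\sigma\mapsto\{\{\sigma(i),\bar i\}:i\in[k]\}$; it is the group of units of $\mathcal{U}_k$. *)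

(* Defs.v *)
From HB Require Import structures.
From mathcomp Require Import all_boot all_order all_fingroup.

Set Implicit Arguments.
Unset Strict Implicit.
Unset Printing Implicit Defensive.

Local Open Scope group_scope.

Section Join.

Variable T : finType.
Implicit Types E : {set {set T}}.

Definition same_block E : rel T :=
  [rel x y | [exists B in E, (x \in B) && (y \in B)]].

(* When E is a union of set partitions of subsets of T, this is their join as *)
(* set partitions of T, each of them being completed with singletons.         *)
Definition components E : {set {set T}} :=
  equivalence_partition (connect (same_block E)) [set: T].

End Join.

Section Diagrams.

Variable k : nat.

(* inl i encodes i and inr i encodes \bar i *)
Notation vertex := ('I_k + 'I_k)%type.
(* inl (inl i), inl (inr i) and inr i encode i, i' and \bar i *)
Notation vertex3 := ('I_k + 'I_k + 'I_k)%type.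

Implicit Types P Q R : {set {set vertex}}.

Definition top_half (x : vertex) : vertex3 := inl x.
Definition bottom_half (x : vertex) : vertex3 :=
  match x with inl i => inl (inr i) | inr i => inr i end.
Definition outer (x : vertex) : vertex3 :=
  match x with inl i => inl (inl i) | inr i => inr i end.

Definition stack P Q : {set {set vertex3}} :=
  [set top_half @: B | B : {set vertex} in P]
    :|: [set bottom_half @: B | B : {set vertex} in Q].

Definition diagram_mul P Q : {set {set vertex}} :=
  [set outer @^-1: C | C : {set vertex3} in components (stack P Q)] :\ set0.

(* The product of 'S_k composes from left to right, so this is an             *)
(* anti-morphism from 'S_k for diagram_mul.                                   *)
Definition perm_diagram (s : 'S_k) : {set {set vertex}} :=
  [set [set inl (s i); inr i] | i : 'I_k].

Definition balanced (B : {set vertex}) :=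
  #|[set i | inl i \in B]| == #|[set i | inr i \in B]|.

Definition uniform_block_partition P :=
  partition P [set: vertex] && [forall B in P, balanced B].

Record ubp := UBP {
  ubp_blocks :> {set {set vertex}};
  ubp_blocksP : uniform_block_partition ubp_blocks }.

HB.instance Definition _ := [isSub for ubp_blocks].
HB.instance Definition _ := [Finite of ubp by <:].

Lemma same_blockE P x y : partition P [set: vertex] ->
  same_block P x y = (y \in pblock P x).
Proof.
case/and3P=> /eqP covP tI _; apply/existsP/idP => [[B /and3P[BP xB yB]]|yx].
  by rewrite (def_pblock tI BP xB).
exists (pblock P x).
by rewrite pblock_mem ?covP ?inE //= mem_pblock covP inE.
Qed.

Lemma partition_ext P Q : partition P [set: vertex] ->
  partition Q [set: vertex] -> same_block P =2 same_block Q -> P = Q.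
Proof.
have sub P' Q' : partition P' [set: vertex] -> partition Q' [set: vertex] ->
    same_block P' =2 same_block Q' -> P' \subset Q'.
  move=> pP pQ eqb; apply/subsetP => B BP.
  have [/eqP covP tP nP] := and3P pP; have [/eqP covQ tQ nQ] := and3P pQ.
  have [x xB] : exists x, x \in B.
    by apply/set0Pn; apply: contraNneq nP => <-.
  suff -> : B = pblock Q' x by rewrite pblock_mem // covQ inE.
  rewrite -(def_pblock tP BP xB); apply/setP => y.
  by rewrite -(same_blockE x y pP) eqb same_blockE.
by move=> pP pQ eqb; apply/eqP; rewrite eqEsubset !sub.
Qed.

Lemma same_block_sym (T : finType) (E : {set {set T}}) :
  symmetric (same_block E).
Proof. by move=> x y; apply: eq_existsb => B; rewrite [(x \in B) && (y \in B)]andbC. Qed.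

Lemma same_block_refl P x : partition P [set: vertex] -> same_block P x x.
Proof. by move=> pP; rewrite same_blockE // mem_pblock (cover_partition pP) inE. Qed.

Lemma same_block_trans P : partition P [set: vertex] ->
  transitive (same_block P).
Proof.
move=> pP y x z; rewrite !same_blockE // => yx.
have [_ tP _] := and3P pP.
by rewrite (same_pblock tP yx).
Qed.

Lemma components_sym (T : finType) (E : {set {set T}}) :
  connect_sym (same_block E).
Proof. exact/sym_connect_sym/same_block_sym. Qed.

Lemma components_equiv (T : finType) (E : {set {set T}}) :
  {in [set: T] & &, equivalence_rel (connect (same_block E))}.
Proof.
move=> x y z _ _ _; split=> [|xy]; first exact: connect0.
exact: (same_connect (@components_sym _ E) xy).
Qed.

Lemma componentsP (T : finType) (E : {set {set T}}) (C : {set T}) :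
  reflect (exists x, C = [set y | connect (same_block E) x y])
          (C \in components E).
Proof.
apply: (iffP imsetP) => [[x _ ->]|[x ->]]; exists x => //.
all: by apply/setP => y; rewrite !inE.
Qed.

Lemma mul_blockP P Q (B : {set vertex}) :
  reflect (exists2 x, B != set0 &
     B = [set y | connect (same_block (stack P Q)) x (outer y)])
    (B \in diagram_mul P Q).
Proof.
rewrite !inE; apply: (iffP andP) => [[B0 /imsetP[C /componentsP[x ->] eqB]]|].
  by exists x => //; rewrite eqB; apply/setP => y; rewrite !inE.
case=> x B0 eqB; split=> //; apply/imsetP.
exists [set y | connect (same_block (stack P Q)) x y].
  by apply/componentsP; exists x.
by rewrite eqB; apply/setP => y; rewrite !inE.
Qed.

Lemma mul_partition P Q : partition (diagram_mul P Q) [set: vertex].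
Proof.
have sc := @same_connect _ _ (@components_sym _ (stack P Q)).
apply/and3P; split.
- apply/eqP/setP => x; rewrite inE; apply/bigcupP.
  exists [set y | connect (same_block (stack P Q)) (outer x) (outer y)].
    apply/mul_blockP; exists (outer x) => //.
    by apply/set0Pn; exists x; rewrite inE connect0.
  by rewrite inE connect0.
- apply/trivIsetP => A B /mul_blockP[x _ ->] /mul_blockP[y _ ->] neAB.
  apply/pred0P => z /=; rewrite !inE; apply/negbTE/negP => /andP[xz yz].
  case/negP: neAB; apply/eqP/setP => t; rewrite !inE.
  by rewrite (sc _ _ xz) (sc _ _ yz).
- by apply/negP => /mul_blockP[x]; rewrite eqxx.
Qed.

Lemma same_block_mul P Q x y :
  same_block (diagram_mul P Q) x y =
  connect (same_block (stack P Q)) (outer x) (outer y).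
Proof.
have sc := @same_connect _ _ (@components_sym _ (stack P Q)).
apply/existsP/idP => [[B /and3P[/mul_blockP[z _ ->]]]|xy].
  by rewrite !inE => zx; rewrite (sc _ _ zx).
exists [set y | connect (same_block (stack P Q)) (outer x) (outer y)].
apply/and3P; split; [|by rewrite inE connect0|by rewrite inE].
apply/mul_blockP; exists (outer x) => //.
by apply/set0Pn; exists x; rewrite inE connect0.
Qed.

Definition embed (S T : finType) (f : S -> T) (e : rel S) : rel T :=
  [rel x y | [exists a, exists b, [&& x == f a, y == f b & e a b]]].

Lemma embedP (S T : finType) (f : S -> T) (e : rel S) x y :
  reflect (exists a b, [/\ x = f a, y = f b & e a b]) (embed f e x y).
Proof.
apply: (iffP existsP) => [[a /existsP[b /and3P[/eqP-> /eqP-> ?]]]|].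
  by exists a, b.
by case=> a [b [-> -> eab]]; exists a; apply/existsP; exists b; rewrite !eqxx.
Qed.

Lemma embed_connect (S T : finType) (f : S -> T) (e : rel S) a y :
  injective f ->
  connect (embed f e) (f a) y <-> exists2 b, y = f b & connect e a b.
Proof.
move=> f_inj; split=> [/connectP[p]|[b -> /connectP[p]]].
  elim: p a => [|z p IHp] a /=; first by move=> _ ->; exists a.
  case/andP=> /embedP[a' [b [/f_inj<- -> eab]]] pth /(IHp _ pth)[c -> bc].
  by exists c => //; apply: connect_trans bc; apply: connect1.
elim: p a => [|z p IHp] a /=; first by move=> _ ->.
case/andP=> eaz pth /(IHp _ pth); apply: connect_trans; apply: connect1.
by apply/embedP; exists a, z.
Qed.

Lemma same_block_stack P Q :
  same_block (stack P Q) =2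
  relU (embed top_half (same_block P)) (embed bottom_half (same_block Q)).
Proof.
move=> x y; apply/existsP/orP => /=.
  case=> B; rewrite !inE => /and3P[/orP[]/imsetP[A AP ->]];
    move=> /imsetP[a aA ->] /imsetP[b bA ->]; [left|right];
    by apply/embedP; exists a, b; split=> //; apply/existsP; exists A; apply/and3P.
case=> /embedP[a [b [-> -> /existsP[A /and3P[AP aA bA]]]]];
  [exists (top_half @: A)|exists (bottom_half @: A)];
  by rewrite !inE !imset_f ?orbT.
Qed.

Lemma connect_restrict (S T : finType) (f : S -> T) (e' : rel S) (e1 e2 : rel T) :
  (forall a b, e' a b -> connect (relU e1 e2) (f a) (f b)) ->
  (forall a b, connect e1 (f a) (f b) -> connect e' a b) ->
  (forall x y, e2 x y -> exists a b, [/\ x = f a, y = f b & e' a b]) ->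
  forall a b, connect e' a b = connect (relU e1 e2) (f a) (f b).
Proof.
move=> H1 H2 H3 a b; apply/idP/idP.
  case/connectP=> p; elim: p a => [|c p IHp] a /=; first by move=> _ ->.
  by case/andP=> /H1 ac pth /(IHp _ pth); apply: connect_trans.
suff key z : connect (relU e1 e2) (f a) z ->
    exists2 c, connect e' a c & connect e1 (f c) z.
  by case/key=> c ac /H2; apply: connect_trans.
case/connectP=> p; elim/last_ind: p z => [|p y IHp] z /=.
  by move=> _ ->; exists a.
rewrite rcons_path last_rcons => /andP[pth /orP lasty] ->.
have [c ac cl] := IHp _ pth erefl.
case: lasty => /= [e1y|/H3[u [v [eu -> uv]]]].
  by exists c => //; apply: connect_trans cl (connect1 e1y).
exists v => //; apply: connect_trans ac _; apply: connect_trans (connect1 uv).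
by apply: H2; rewrite -eu.
Qed.

Definition saturated P (D : {set vertex}) :=
  forall x y, same_block P x y -> x \in D -> y \in D.

Lemma saturated_balanced P D :
  uniform_block_partition P -> saturated P D -> balanced D.
Proof.
case/andP=> pP /forall_inP balP satD.
have cardE (g : 'I_k -> vertex) : injective g -> forall B : {set vertex},
    #|[set i | g i \in B]| = \sum_(x in B) (x \in codom g).
  move=> g_inj B; rewrite -big_mkcondr sum1_card /=.
  rewrite -(card_imset _ g_inj); apply: eq_card => x.
  apply/imsetP/andP => [[i] |[xB /codomP[i eqx]]].
    by rewrite !inE => giB ->; rewrite giB codom_f.
  by exists i; rewrite ?inE -?eqx.
have inlI : injective (inl : 'I_k -> vertex) by move=> ? ? [].
have inrI : injective (inr : 'I_k -> vertex) by move=> ? ? [].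
have split_sum (g : 'I_k -> vertex) :
    \sum_(x in D) (x \in codom g)
    = \sum_(B in P) \sum_(x in B) (x \in D) * (x \in codom g).
  rewrite -(set_partition_big _ pP) /= [RHS](eq_bigl xpredT); last first.
    by move=> x; rewrite inE.
  by rewrite big_mkcond; apply: eq_bigr => x _; case: ifP; rewrite ?mul1n ?mul0n.
rewrite /balanced !cardE // !split_sum; apply/eqP; apply: eq_bigr => B BP.
have [/existsP[x /andP[xB xD]]|/existsPn nBD] :=
  boolP [exists x, (x \in B) && (x \in D)].
  have sBD y : y \in B -> y \in D.
    move=> yB; apply: (satD x) xD; apply/existsP; exists B; exact/and3P.
  have inD (g : 'I_k -> vertex) : \sum_(y in B) (y \in D) * (y \in codom g)
      = \sum_(y in B) (y \in codom g).
    by apply: eq_bigr => y /sBD->; rewrite mul1n.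
  by rewrite !inD -!cardE //; apply/eqP; apply: balP.
by rewrite !big1 // => y yB; have := nBD y; rewrite yB /= => /negbTE->.
Qed.

Lemma mul_uniform P Q : uniform_block_partition P -> uniform_block_partition Q ->
  uniform_block_partition (diagram_mul P Q).
Proof.
move=> uP uQ; rewrite /uniform_block_partition mul_partition /=.
apply/forall_inP => B /mul_blockP[x _ ->].
pose C := [set y | connect (same_block (stack P Q)) x y].
have step y z : same_block (stack P Q) y z -> y \in C -> z \in C.
  by rewrite !inE => yz /connect_trans; apply; apply: connect1.
have satP : saturated P (top_half @^-1: C).
  move=> a b ab; rewrite !inE => aC.
  have := @step (top_half a) (top_half b); rewrite !inE; apply=> //.
  by rewrite same_block_stack; apply/orP; left; apply/embedP; exists a, b.
have satQ : saturated Q (bottom_half @^-1: C).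
  move=> a b ab; rewrite !inE => aC.
  have := @step (bottom_half a) (bottom_half b); rewrite !inE; apply=> //.
  by rewrite same_block_stack; apply/orP; right; apply/embedP; exists a, b.
have := saturated_balanced uP satP; have := saturated_balanced uQ satQ.
rewrite /balanced => /eqP eQ /eqP eP; apply/eqP.
transitivity #|[set i | inl i \in top_half @^-1: C]|.
  by apply: eq_card => i; rewrite !inE.
rewrite {}eP; transitivity #|[set i | inr i \in bottom_half @^-1: C]|.
  by rewrite -eQ; apply: eq_card => i; rewrite !inE.
by apply: eq_card => i; rewrite !inE.
Qed.

Lemma perm_blockP (s : 'S_k) x y :
  same_block (perm_diagram s) x y =
  [exists i, (x \in [set inl (s i); inr i]) && (y \in [set inl (s i); inr i])].
Proof.
apply/existsP/existsP => [[B /and3P[/imsetP[i _ ->] xi yi]]|[i /andP[xi yi]]].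
  by exists i; apply/andP.
by exists [set inl (s i); inr i]; rewrite xi yi !andbT; apply: imset_f.
Qed.

Lemma perm_uniform (s : 'S_k) : uniform_block_partition (perm_diagram s).
Proof.
apply/andP; split; last first.
  apply/forall_inP => B /imsetP[i _ ->]; apply/eqP.
  transitivity #|[set s i]|.
    by apply: eq_card => j; rewrite !inE orbF.
  rewrite cards1 -(cards1 i).
  by apply: eq_card => j; rewrite !inE.
apply/and3P; split.
- apply/eqP/setP => x; rewrite inE; apply/bigcupP.
  case: x => i.
    exists [set inl (s (s^-1 i)); inr (s^-1 i)]; first exact: imset_f.
    by rewrite permKV !inE eqxx.
  exists [set inl (s i); inr i]; first exact: imset_f.
  by rewrite !inE eqxx orbT.
- apply/trivIsetP => _ _ /imsetP[i _ ->] /imsetP[j _ ->] neq.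
  apply/pred0P => z /=; apply/negbTE/negP; rewrite !inE => /andP[zi zj].
  case/negP: neq; suff -> : i = j by [].
  case: z zi zj => z; rewrite ?orbF /=.
    by move=> /eqP[->] /eqP[/perm_inj].
  by move=> /eqP[->] /eqP[].
- apply/negP => /imsetP[i _] /setP/(_ (inr i)).
  by rewrite !inE eqxx orbT.
Qed.

Lemma one_blockE x y : same_block (perm_diagram 1) x y =
  (match x with inl i => i | inr i => i end
   == match y with inl i => i | inr i => i end).
Proof.
rewrite perm_blockP; apply/existsP/eqP => [[i]|eqxy].
  by rewrite !perm1 !inE => /andP[/orP[]/eqP-> /orP[]/eqP->].
exists (match x with inl i => i | inr i => i end); rewrite !perm1 !inE.
by case: x y eqxy => i [] j /= ->; rewrite !eqxx ?orbT.
Qed.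

Lemma mul1_diagram P : partition P [set: vertex] ->
  diagram_mul (perm_diagram 1) P = P.
Proof.
move=> pP; apply: partition_ext => // [|x y]; first exact: mul_partition.
rewrite same_block_mul (eq_connect (@same_block_stack _ _)).
pose h (z : vertex3) : vertex :=
  match z with inl (inl i) => inl i | inl (inr i) => inl i | inr i => inr i end.
have hK z : h (outer z) = z by case: z.
apply/idP/idP => [|xy].
  suff key u v : connect (relU (embed top_half (same_block (perm_diagram 1)))
      (embed bottom_half (same_block P))) u v -> same_block P (h u) (h v).
    by move/key; rewrite !hK.
  case/connectP=> p; elim: p u => [|w p IHp] u /=.
    by move=> _ ->; apply: same_block_refl.
  case/andP=> /orP uw pth /(IHp _ pth); apply: same_block_trans => //.
  case: uw => /embedP[a [b [-> -> /=]]].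
    rewrite one_blockE.
    by case: a b => i [] j /eqP-> /=; apply: same_block_refl.
  by case: a b => i [] j.
have leg (z : vertex) : connect (relU (embed top_half (same_block (perm_diagram 1)))
      (embed bottom_half (same_block P))) (outer z) (bottom_half z).
  case: z => i /=; last exact: connect0.
  apply/connect1/orP; left; apply/embedP; exists (inl i), (inr i); split=> //.
  by rewrite one_blockE.
apply: connect_trans (leg x) _.
have symR : connect_sym (relU (embed top_half (same_block (perm_diagram 1)))
      (embed bottom_half (same_block P))).
  move=> u v; rewrite -!(eq_connect (@same_block_stack _ _)).
  exact: components_sym.
rewrite symR; apply: connect_trans (leg y) _; rewrite symR.
by apply/connect1/orP; right; apply/embedP; exists x, y.
Qed.

Lemma diagram_mul1 P : partition P [set: vertex] ->
  diagram_mul P (perm_diagram 1) = P.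
Proof.
move=> pP; apply: partition_ext => // [|x y]; first exact: mul_partition.
rewrite same_block_mul (eq_connect (@same_block_stack _ _)).
pose h (z : vertex3) : vertex :=
  match z with inl (inl i) => inl i | inl (inr i) => inr i | inr i => inr i end.
have hK z : h (outer z) = z by case: z.
apply/idP/idP => [|xy].
  suff key u v : connect (relU (embed top_half (same_block P))
      (embed bottom_half (same_block (perm_diagram 1)))) u v ->
      same_block P (h u) (h v).
    by move/key; rewrite !hK.
  case/connectP=> p; elim: p u => [|w p IHp] u /=.
    by move=> _ ->; apply: same_block_refl.
  case/andP=> /orP uw pth /(IHp _ pth); apply: same_block_trans => //.
  case: uw => /embedP[a [b [-> -> /=]]].
    by case: a b => i [] j.
  rewrite one_blockE.
  by case: a b => i [] j /eqP-> /=; apply: same_block_refl.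
have leg (z : vertex) : connect (relU (embed top_half (same_block P))
      (embed bottom_half (same_block (perm_diagram 1)))) (top_half z) (outer z).
  case: z => i /=; first exact: connect0.
  apply/connect1/orP; right; apply/embedP; exists (inl i), (inr i); split=> //.
  by rewrite one_blockE.
have symR : connect_sym (relU (embed top_half (same_block P))
      (embed bottom_half (same_block (perm_diagram 1)))).
  move=> u v; rewrite -!(eq_connect (@same_block_stack _ _)).
  exact: components_sym.
apply: connect_trans (leg y); rewrite symR; apply: connect_trans (leg x).
rewrite symR.
by apply/connect1/orP; left; apply/embedP; exists x, y.
Qed.

Notation vertex4 := ('I_k + 'I_k + 'I_k + 'I_k)%type.

Definition level4 (n : nat) (i : 'I_k) : vertex4 :=
  match n with
  | 0 => inl (inl (inl i)) | 1 => inl (inl (inr i)) | 2 => inl (inr i)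
  | _ => inr i end.
Definition pair4 (m n : nat) (x : vertex) : vertex4 :=
  match x with inl i => level4 m i | inr i => level4 n i end.
Definition triple4 (l m n : nat) (x : vertex3) : vertex4 :=
  match x with
  | inl (inl i) => level4 l i | inl (inr i) => level4 m i | inr i => level4 n i
  end.

Definition stack4 P Q R : rel vertex4 := fun x y =>
  [|| embed (pair4 0 1) (same_block P) x y, embed (pair4 1 2) (same_block Q) x y
    | embed (pair4 2 3) (same_block R) x y].

Lemma triple_top l m n x : triple4 l m n (top_half x) = pair4 l m x.
Proof. by case: x. Qed.
Lemma triple_bottom l m n x : triple4 l m n (bottom_half x) = pair4 m n x.
Proof. by case: x. Qed.
Lemma triple_outer l m n x : triple4 l m n (outer x) = pair4 l n x.
Proof. by case: x. Qed.

Lemma embed_triple l m n P Q :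
  embed (triple4 l m n) (same_block (stack P Q)) =2
  relU (embed (pair4 l m) (same_block P)) (embed (pair4 m n) (same_block Q)).
Proof.
move=> x y; apply/embedP/orP => /=.
  case=> a [b [-> ->]]; rewrite same_block_stack.
  case/orP=> /embedP[c [d [-> -> cd]]]; [left|right]; apply/embedP;
  by exists c, d; rewrite ?triple_top ?triple_bottom.
case=> /embedP[c [d [-> -> cd]]].
  exists (top_half c), (top_half d); rewrite !triple_top same_block_stack.
  by split=> //; apply/orP; left; apply/embedP; exists c, d.
exists (bottom_half c), (bottom_half d); rewrite !triple_bottom same_block_stack.
by split=> //; apply/orP; right; apply/embedP; exists c, d.
Qed.

Lemma connect_eq_sub (T : finType) (e e' : rel T) x y :
  subrel e e' -> connect e x y -> connect e' x y.
Proof. by move=> ee'; apply: connect_sub => u v /ee'; apply: connect1. Qed.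

Lemma mulA_left P Q R x y :
  same_block (diagram_mul (diagram_mul P Q) R) x y =
  connect (stack4 P Q R) (pair4 0 3 x) (pair4 0 3 y).
Proof.
rewrite same_block_mul.
have inj012 : injective (triple4 0 1 2).
  by move=> [[i|i]|i] [[j|j]|j] //= [->].
rewrite (@connect_restrict _ _ (triple4 0 2 3) _
  (embed (triple4 0 1 2) (same_block (stack P Q)))
  (embed (pair4 2 3) (same_block R))).
- rewrite !triple_outer; apply: eq_connect => u v /=.
  by rewrite embed_triple /stack4 /= orbA.
- move=> a b; rewrite same_block_stack /=.
  case/orP=> /embedP[c [d [-> ->]]].
    rewrite same_block_mul !triple_top -!(triple_outer 0 1 2) => cd.
    apply: (@connect_eq_sub _ (embed (triple4 0 1 2) (same_block (stack P Q)))).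
      by move=> u v uv; apply/orP; left.
    by apply/embed_connect => //; exists (outer d).
  rewrite !triple_bottom => cd; apply/connect1/orP; right.
  by apply/embedP; exists c, d.
- move=> a b.
  case: (boolP [exists c, a == top_half c]) => [/existsP[c /eqP->]|na].
    rewrite triple_top -(triple_outer 0 1 2).
    case/embed_connect=> // d eqd cd.
    have [d' eb ed] : exists2 d', b = top_half d' & d = outer d'.
      case: b d eqd {cd} => [[i|i]|i] [[j|j]|j] //= [->].
        by exists (inl j).
      by exists (inr j).
    rewrite eb; apply: connect1; rewrite same_block_stack; apply/orP; left.
    apply/embedP; exists c, d'; split=> //.
    by rewrite same_block_mul -ed.
  case/connectP=> [[|z p]] /=.
    move=> _ eab; suff -> : b = a by exact: connect0.
    by case: a b eab {na} => [[i|i]|i] [[j|j]|j] //= [->].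
  case/andP=> /embedP[u [v [eau _ _]]] _ _; case/negP: na.
  case: a u eau => [[i|i]|i] [[j|j]|j] //= [->]; apply/existsP.
    by exists (inl j).
  by exists (inr j).
- move=> u v /embedP[a [b [-> -> ab]]].
  exists (bottom_half a), (bottom_half b); rewrite !triple_bottom; split=> //.
  by rewrite same_block_stack; apply/orP; right; apply/embedP; exists a, b.
Qed.

Lemma mulA_right P Q R x y :
  same_block (diagram_mul P (diagram_mul Q R)) x y =
  connect (stack4 P Q R) (pair4 0 3 x) (pair4 0 3 y).
Proof.
rewrite same_block_mul.
have inj123 : injective (triple4 1 2 3).
  by move=> [[i|i]|i] [[j|j]|j] //= [->].
rewrite (@connect_restrict _ _ (triple4 0 1 3) _
  (embed (triple4 1 2 3) (same_block (stack Q R)))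
  (embed (pair4 0 1) (same_block P))).
- rewrite !triple_outer; apply: eq_connect => u v /=.
  by rewrite embed_triple /stack4 /= orbC.
- move=> a b; rewrite same_block_stack /=.
  case/orP=> /embedP[c [d [-> ->]]]; last first.
    rewrite same_block_mul !triple_bottom -!(triple_outer 1 2 3) => cd.
    apply: (@connect_eq_sub _ (embed (triple4 1 2 3) (same_block (stack Q R)))).
      by move=> u v uv; apply/orP; left.
    by apply/embed_connect => //; exists (outer d).
  rewrite !triple_top => cd; apply/connect1/orP; right.
  by apply/embedP; exists c, d.
- move=> a b.
  case: (boolP [exists c, a == bottom_half c]) => [/existsP[c /eqP->]|na].
    rewrite triple_bottom -(triple_outer 1 2 3).
    case/embed_connect=> // d eqd cd.
    have [d' eb ed] : exists2 d', b = bottom_half d' & d = outer d'.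
      case: b d eqd {cd} => [[i|i]|i] [[j|j]|j] //= [->].
        by exists (inl j).
      by exists (inr j).
    rewrite eb; apply: connect1; rewrite same_block_stack; apply/orP; right.
    apply/embedP; exists c, d'; split=> //.
    by rewrite same_block_mul -ed.
  case/connectP=> [[|z p]] /=.
    move=> _ eab; suff -> : b = a by exact: connect0.
    by case: a b eab {na} => [[i|i]|i] [[j|j]|j] //= [->].
  case/andP=> /embedP[u [v [eau _ _]]] _ _; case/negP: na.
  case: a u eau => [[i|i]|i] [[j|j]|j] //= [->]; apply/existsP.
    by exists (inl j).
  by exists (inr j).
- move=> u v /embedP[a [b [-> -> ab]]].
  exists (top_half a), (top_half b); rewrite !triple_top; split=> //.
  by rewrite same_block_stack; apply/orP; left; apply/embedP; exists a, b.
Qed.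

Lemma diagram_mulA P Q R :
  diagram_mul P (diagram_mul Q R) = diagram_mul (diagram_mul P Q) R.
Proof.
apply: partition_ext; try exact: mul_partition.
by move=> x y; rewrite mulA_left mulA_right.
Qed.

Definition ubp_perm (s : 'S_k) : ubp := UBP (perm_uniform s).
Definition ubp_mul (p q : ubp) : ubp :=
  UBP (mul_uniform (ubp_blocksP p) (ubp_blocksP q)).

Lemma ubp_partition (p : ubp) : partition p [set: vertex].
Proof. by case/andP: (ubp_blocksP p). Qed.

Lemma ubp_mulA : associative ubp_mul.
Proof. by move=> p q r; apply: val_inj; apply: diagram_mulA. Qed.
Lemma ubp_1mul : left_id (ubp_perm 1) ubp_mul.
Proof. by move=> p; apply: val_inj; apply: mul1_diagram (ubp_partition p). Qed.
Lemma ubp_mul1 : right_id (ubp_perm 1) ubp_mul.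
Proof. by move=> p; apply: val_inj; apply: diagram_mul1 (ubp_partition p). Qed.

HB.instance Definition _ := isMonoid.Build ubp ubp_mulA ubp_1mul ubp_mul1.

Definition ubp_sym : {set ubp} := [set ubp_perm s | s : 'S_k].

End Diagrams.

(* Main.v *)
(* A submonoid containing the permutations is determined by the family of the
   equivalence relations that its elements induce on the top points. Such a
   family is closed under conjugation and join, and a product p q induces the
   join of the relation of p with a conjugate of that of q. It remains to see
   that, for two such families, the join G of E in the first one and F in the
   second one belongs to one of them. If E is nontrivial on every class of G
   with at least two points, then G is a join of conjugates of E. Otherwise take
   a smallest class of G with at least two points on which E or F is discrete,
   say F. There E is full, and G is a join of conjugates of E: on each class
   where E is discrete, swap a part of it with the smallest class. *)

Require Import Defs.
From HB Require Import structures.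
From mathcomp Require Import all_boot all_order all_fingroup.

Set Implicit Arguments.
Unset Strict Implicit.
Unset Printing Implicit Defensive.

Local Open Scope group_scope.

(** * Equivalence relations and their joins *)

Definition equiv_rel (T : Type) (E : rel T) :=
  [/\ reflexive E, symmetric E & transitive E].

Lemma equiv_rel_preim (S T : Type) (f : S -> T) (E : rel T) :
  equiv_rel E -> equiv_rel (relpre f E).
Proof.
by case=> rE sE tE; split=> [x|x y|y x z] /=; [exact: rE|exact: sE|exact: tE].
Qed.

Section Relations.

Variable T : finType.
Implicit Types E F G : rel T.

Definition join_rel E F : rel T := connect (relU E F).

Lemma join_rel_subl E F : subrel E (join_rel E F).
Proof. by move=> x y Exy; apply/connect1/orP; left. Qed.

Lemma join_rel_subr E F : subrel F (join_rel E F).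
Proof. by move=> x y Fxy; apply/connect1/orP; right. Qed.

Lemma join_rel_min E F G :
  equiv_rel G -> subrel E G -> subrel F G -> subrel (join_rel E F) G.
Proof.
move=> [Grefl _ Gtrans] EG FG x y /connectP[p].
elim: p x => [|z p IHp] x /=; first by move=> _ ->.
case/andP=> /orP xz pth /(IHp _ pth); apply: Gtrans.
by case: xz => [/EG|/FG].
Qed.

Lemma join_rel_equiv E F : equiv_rel E -> equiv_rel F -> equiv_rel (join_rel E F).
Proof.
move=> [_ symE _] [_ symF _]; split=> [x|x y|]; first exact: connect0.
  by apply: sym_connect_sym => u v /=; rewrite symE symF.
exact: connect_trans.
Qed.

Lemma join_relC E F : join_rel E F =2 join_rel F E.
Proof. by apply: eq_connect => x y /=; rewrite orbC. Qed.

(** * Families of relations closed under conjugation and join *)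

Record conj_join_closed (C : rel T -> Prop) : Prop := {
  closed_ext : forall E F, E =2 F -> C E -> C F;
  closed_conj : forall E (s : {perm T}), C E -> C (relpre s E);
  closed_join : forall E F, C E -> C F -> C (join_rel E F) }.

(** A first transposition takes [x] to [u], a second one the image [y'] of [y] to [v]; both exchange
    points of one class of [G]. *)
Lemma move_pair G x y u v : equiv_rel G -> x != y -> u != v ->
    G x y -> G x u -> G x v ->
  exists s : {perm T}, [/\ s x = u, s y = v & forall z, G z (s z)].
Proof.
move=> [rG sG tG] xy uv Gxy Gxu Gxv.
have GT a b z : G a b -> G z (tperm a b z).
  by case: tpermP => [-> //|-> |//]; rewrite sG.
pose y' := tperm x u y.
have y'u : y' != u by rewrite -(tpermL x u) (inj_eq perm_inj) eq_sym.
have Gxy' : G x y' := tG _ _ _ Gxy (GT _ _ y Gxu).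
exists (tperm x u * tperm y' v); split=> [||z]; rewrite permM.
- by rewrite tpermL tpermD // eq_sym.
- by rewrite tpermL.
apply: (tG) (GT _ _ _ Gxu) (GT _ _ _ _).
by apply: tG Gxv; rewrite sG.
Qed.

(** [A] is exchanged with the first elements of an enumeration of [B]; the rest of [B] stays
    fixed. *)
Lemma swap_into (A B : {set T}) : [disjoint A & B] -> #|A| <= #|B| ->
  exists s : {perm T},
    [/\ involutive s, {in A, forall z, s z \in B},
        {in B, forall z, s z \in A \/ s z = z}
      & forall z, z \notin A -> z \notin B -> s z = z].
Proof.
case: (pickP T) => [t0 _ dAB leAB|T0]; last first.
  by move=> _ _; exists 1; split=> x; have := T0 x.
pose a := enum A; pose b := take #|A| (enum B).
have szb : size b = size a by rewrite size_takel -?cardE.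
have ua : uniq a := enum_uniq A.
have ub : uniq b by rewrite take_uniq ?enum_uniq.
have aA z : (z \in a) = (z \in A) by rewrite mem_enum.
have bB z : z \in b -> z \in B by move/mem_take; rewrite mem_enum.
have nab z : z \in b -> (z \in a) = false.
  by move/bB=> zB; rewrite aA (disjointFl dAB).
pose f z := if z \in a then nth t0 b (index z a)
            else if z \in b then nth t0 a (index z b) else z.
have fab z : z \in a -> f z \in b.
  by move=> za; rewrite /f za mem_nth // szb index_mem.
have fba z : z \in b -> f z \in a.
  by move=> zb; rewrite /f (nab _ zb) zb mem_nth // -szb index_mem.
have fK : involutive f.
  move=> z; have [za|nza] := boolP (z \in a).
    have := fab z za; rewrite {2}/f => zb; rewrite (nab _ zb) zb /f za.
    by rewrite index_uniq ?szb ?index_mem // nth_index.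
  have [zb|nzb] := boolP (z \in b).
    have := fba z zb; rewrite {2}/f => za; rewrite za /f (nab _ zb) zb.
    by rewrite index_uniq -?szb ?index_mem // nth_index.
  by rewrite /f (negbTE nza) (negbTE nzb) (negbTE nza) (negbTE nzb).
exists (perm (inv_inj fK)); split=> [z|z|z zB|z].
- by rewrite !permE fK.
- by rewrite -aA permE => /fab/bB.
- rewrite permE; have [/fba|nzb] := boolP (z \in b); first by rewrite aA; left.
  by right; rewrite /f aA (disjointFl dAB zB) (negbTE nzb).
- move=> nzA nzB; rewrite permE /f aA (negbTE nzA).
  by rewrite (contraNF (@bB z) nzB).
Qed.

Section Closed.

Variable C : rel T -> Prop.
Hypothesis closC : conj_join_closed C.

(* Conjugating inside the classes of [G], a single nontrivial pair in a class *)
(* yields all the pairs of this class.                                        *)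
Lemma closed_gen E G : equiv_rel G -> C E -> subrel E G ->
    (forall x y, x != y -> G x y ->
       exists F u v, [/\ C F, subrel F G, u != v, F u v & G x u]) ->
  C G.
Proof.
move=> eqG CE EG H; have [rG sG tG] := eqG.
have {}H x y : x != y -> G x y -> exists F, [/\ C F, subrel F G & F x y].
  move=> xy Gxy; have [F [u [v [CF FG uv Fuv Gxu]]]] := H x y xy Gxy.
  have [s [sx sy Gs]] := move_pair eqG xy uv Gxy Gxu (tG _ _ _ Gxu (FG _ _ Fuv)).
  exists (relpre s F); split; first exact: closed_conj.
    by move=> a b /= /FG Gab; apply: (tG) (Gs a) (tG _ _ _ Gab _); rewrite sG.
  by rewrite /= sx sy.
have [F [CF FG FH]] : exists F, [/\ C F, subrel F G
    & forall p : T * T, p \in enum {: T * T} ->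
        p.1 != p.2 -> G p.1 p.2 -> F p.1 p.2].
  elim: (enum _) => [|[x y] l [F [CF FG FH]]]; first by exists E.
  have [/andP[xy Gxy]|nxy] := boolP ((x != y) && G x y).
    have [F' [CF' F'G F'xy]] := H x y xy Gxy.
    exists (join_rel F F'); split; first exact: closed_join.
      exact: join_rel_min.
    move=> p; rewrite inE => /orP[/eqP->|pl] p12 Gp.
      exact: join_rel_subr.
    by apply: join_rel_subl; apply: FH.
  exists F; split=> // p; rewrite inE => /orP[/eqP->|pl]; last exact: FH.
  by move=> p12 Gp; case/negP: nxy; apply/andP.
(* [F] is only known to contain the pairs of distinct points of [G]; joining it with itself adds the
   diagonal. *)
apply: closed_ext (closed_join closC CF CF) => // x y.
apply/idP/idP => [|Gxy]; first exact: join_rel_min.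
have [->|xy] := eqVneq x y; first exact: connect0.
by apply: join_rel_subl; apply: (FH (x, y)); rewrite ?mem_enum.
Qed.

End Closed.

(** * Discreteness on a class, and the choice between two families *)

(** Singleton classes are excluded: any relation below [G] is discrete there. *)
Definition discrete_on E G x :=
  [exists y, (x != y) && G x y]
  && [forall u, forall v, G x u && E u v ==> (u == v)].

Lemma discrete_onP E G x u v : discrete_on E G x -> G x u -> E u v -> u = v.
Proof.
by case/andP=> _ /'forall_forallP/(_ u v)/implyP uv xu Euv;
   apply/eqP/uv; rewrite xu.
Qed.

Lemma not_discrete_on E G x y : ~~ discrete_on E G x -> x != y -> G x y ->
  exists u v, [/\ u != v, E u v & G x u].
Proof.
move=> nd xy Gxy; move: nd; rewrite negb_and; case/orP.
  by case/existsP; exists y; rewrite xy.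
case/forallPn=> u /forallPn[v]; rewrite negb_imply => /andP[/andP[Gxu Euv] uv].
by exists u, v.
Qed.

(** On a path from [x], every step of [F] starts in the class of [x], hence is a loop. *)
Lemma join_rel_discrete E F x y : equiv_rel E ->
  discrete_on F (join_rel E F) x -> join_rel E F x y -> E x y.
Proof.
move=> [rE _ tE] dF /connectP[p]; elim/last_ind: p y => [|p z IHp] y /=.
  by move=> _ ->; apply: rE.
rewrite rcons_path last_rcons => /andP[pth /orP lz] ->.
have {IHp} Exl := IHp _ pth erefl.
case: lz => /= [|Fl]; first exact: tE.
by rewrite -(discrete_onP dF (join_rel_subl _ Exl) Fl).
Qed.

(* [F] being discrete on the class of [x0] in the join, [E] is full there;    *)
(* on each class where [E] is discrete, this class being larger, a swap       *)
(* brings there the full block of [E].                                        *)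
Lemma join_rel_closed C E F x0 : conj_join_closed C ->
    equiv_rel E -> equiv_rel F -> C E ->
    discrete_on F (join_rel E F) x0 ->
    (forall x, discrete_on E (join_rel E F) x ->
       #|join_rel E F x0| <= #|join_rel E F x|) ->
  C (join_rel E F).
Proof.
move=> closC eqE eqF CE dF minx0; set G := join_rel E F in dF minx0 *.
have eqG : equiv_rel G by apply: join_rel_equiv.
have [rG sG tG] := eqG.
have EG : subrel E G by apply: join_rel_subl.
apply: (closed_gen closC eqG CE EG) => x y xy Gxy.
have [dE|nd] := boolP (discrete_on E G x); last first.
  have [u [v [uv Euv Gxu]]] := not_discrete_on nd xy Gxy.
  by exists E, u, v.
have [/existsP[y0 /andP[x0y0 Gx0y0]] _] := andP dF.
have Ex0 z : G x0 z -> E x0 z by apply: join_rel_discrete.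
have nGxx0 : ~~ G x x0.
  by apply: contraNN x0y0 => Gxx0; rewrite (discrete_onP dE Gxx0 (Ex0 _ Gx0y0)).
pose A := [set z | G x0 z]; pose B := [set z | G x z].
have dAB : [disjoint A & B].
  apply/pred0P => z; apply: contraNF nGxx0; rewrite !inE => /andP[x0z xz].
  by apply: tG xz _; rewrite sG.
have leAB : #|A| <= #|B| by rewrite !cardsE minx0.
have [s [sK sA sB sN]] := swap_into dAB leAB.
(* Since [s] is an involution, the pair [x0], [y0] of [E] becomes a pair of [relpre s E] in the
   class of [x]. *)
exists (relpre s E), (s x0), (s y0); split.
- exact: closed_conj.
(* For [a] in [A] or fixed in [B], [s a] is in the class of [x], where [E] is discrete. For [a] sent
   from [B] to [A], [b] is in [B] too. Elsewhere [s] fixes both points. *)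
- move=> a b /= Eab; have Gab := EG _ _ Eab.
  have disc : G x (s a) -> a = b.
    by move=> Ga; apply: (can_inj sK); apply: discrete_onP dE Ga Eab.
  have [aA|naA] := boolP (a \in A).
    by rewrite disc //; have := sA _ aA; rewrite inE.
  have [aB|naB] := boolP (a \in B).
    have [saA|sa] := sB _ aB; last first.
      by rewrite disc //; rewrite sa; rewrite inE in aB.
    have : s b \in A by move: saA; rewrite !inE => /tG; apply.
    move/sA; rewrite sK; move: aB; rewrite !inE => xa xb.
    by apply: tG xb; rewrite sG.
  rewrite (sN a) // in Gab.
  have sbA : s b \notin A.
    by apply: contraNN naA; rewrite !inE => /tG; apply; rewrite sG.
  have sbB : s b \notin B.
    by apply: contraNN naB; rewrite !inE => /tG; apply; rewrite sG.
  by have := sN _ sbA sbB; rewrite sK => ->.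
- by rewrite (inj_eq perm_inj).
- by rewrite /= !sK Ex0.
- by have := sA x0; rewrite !inE; apply; apply: rG.
Qed.

Lemma closed_join_or C1 C2 E F :
  conj_join_closed C1 -> conj_join_closed C2 -> equiv_rel E -> equiv_rel F ->
  C1 E -> C2 F -> C1 (join_rel E F) \/ C2 (join_rel E F).
Proof.
move=> clos1 clos2 eqE eqF CE CF; pose G := join_rel E F.
have eqG : equiv_rel G by apply: join_rel_equiv.
have [x1 d1|nd] := pickP [pred x | discrete_on E G x || discrete_on F G x];
  last first.
  left; apply: (closed_gen clos1 eqG CE (@join_rel_subl _ _)) => x y xy Gxy.
  have [|u [v [uv Euv Gxu]]] := @not_discrete_on E G x y _ xy Gxy.
    by have /norP[] := negbT (nd x).
  by exists E, u, v; split=> //; apply: join_rel_subl.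
(* Minimizing over the classes discrete for either relation bounds the size whichever one is
   discrete at [x0]; the other one then generates the join. *)
have [x0 /orP dx0 minx0] := arg_minnP (fun x => #|G x|) d1.
case: dx0 => dx0; [right|left]; last first.
  by apply: (join_rel_closed clos1 _ _ _ dx0) => // x dx; apply: minx0; rewrite /= dx.
apply: (closed_ext clos2 (join_relC F E)).
have eqd H x : discrete_on H (join_rel F E) x = discrete_on H G x.
  congr (_ && _).
    by apply: eq_existsb => u; rewrite join_relC.
  by apply: eq_forallb => u; apply: eq_forallb => v; rewrite join_relC.
apply: (@join_rel_closed _ _ _ x0) => //; first by rewrite eqd.
move=> x; rewrite eqd => dx.
have cardG y : #|join_rel F E y| = #|G y|.
  by apply: eq_card => z; rewrite -!topredE /= join_relC.
by rewrite !cardG; apply: minx0; rewrite /= dx orbT.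
Qed.

End Relations.

(** * The relation induced by a diagram on its top points *)

Section Tops.

Variable k : nat.
Implicit Types (p q : ubp k) (s t : 'S_k).

Definition top_rel p : rel 'I_k := fun i j => same_block p (inl i) (inl j).

(** Such a permutation and the top relation together determine the diagram. *)
Definition matched s p := forall i, same_block p (inl (s i)) (inr i).

Lemma same_block_equiv p : equiv_rel (same_block p).
Proof.
have pP := ubp_partition p.
split=> [x||]; first exact: same_block_refl.
  exact: same_block_sym.
exact: same_block_trans.
Qed.

Lemma top_rel_equiv p : equiv_rel (top_rel p).
Proof. exact: equiv_rel_preim (same_block_equiv p). Qed.

(** Blocks being balanced, the n-th bottom point of each block can be sent to its n-th top point. *)
Lemma exists_matched p : exists s, matched s p.
Proof.
have [covP tP _] := and3P (ubp_partition p).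
have /andP[_ /forall_inP balP] := ubp_blocksP p.
pose B i := pblock p (inr i).
have Bi i : inr i \in B i by rewrite mem_pblock (eqP covP) inE.
have BP i : B i \in ubp_blocks p by rewrite pblock_mem // (eqP covP) inE.
pose N i := enum [set j | inl j \in B i].
pose M i := enum [set j | inr j \in B i].
have szMN i : size (N i) = size (M i) by rewrite -!cardE; apply/eqP/balP.
have iM i : i \in M i by rewrite mem_enum inE.
pose f i := nth i (N i) (index i (M i)).
have fN i : f i \in N i by rewrite mem_nth // szMN index_mem.
have fB i : inl (f i) \in B i by have := fN i; rewrite mem_enum inE.
have f_inj : injective f.
  move=> i j fij.
  have eqB : B i = B j.
    by rewrite -(def_pblock tP (BP i) (fB i)) -(def_pblock tP (BP j) (fB j)) fij.
  have iMj : i \in M j by rewrite /M -eqB; apply: iM.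
  move/eqP: fij; rewrite /f /N /M eqB -/(N j) -/(M j).
  (* The two values of [f] use different defaults, [i] and [j]; these must agree before uniqueness
     applies. *)
  rewrite (set_nth_default j) ?szMN ?index_mem //.
  rewrite nth_uniq ?szMN ?index_mem ?enum_uniq // => /eqP eqi.
  by rewrite -(nth_index j iMj) eqi nth_index.
exists (perm f_inj) => i; rewrite permE.
by apply/existsP; exists (B i); rewrite BP fB Bi.
Qed.

Lemma matched_perm s : matched s (ubp_perm s).
Proof.
by move=> i; rewrite perm_blockP; apply/existsP; exists i; rewrite !inE !eqxx orbT.
Qed.

Lemma top_rel_perm s i j : top_rel (ubp_perm s) i j = (i == j).
Proof.
rewrite /top_rel perm_blockP; apply/existsP/eqP => [[l]|->].
  by rewrite !inE !orbF => /andP[/eqP[->] /eqP[->]].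
by exists (s^-1 j); rewrite permKV !inE eqxx.
Qed.

Lemma stack_top p q x y : same_block p x y ->
  connect (same_block (stack p q)) (top_half x) (top_half y).
Proof.
move=> xy; apply/connect1; rewrite same_block_stack; apply/orP; left.
by apply/embedP; exists x, y.
Qed.

Lemma stack_bottom p q x y : same_block q x y ->
  connect (same_block (stack p q)) (bottom_half x) (bottom_half y).
Proof.
move=> xy; apply/connect1; rewrite same_block_stack; apply/orP; right.
by apply/embedP; exists x, y.
Qed.

(** Bottom point [i] is linked to the middle point [t i], then to the top point [s (t i)];
    permutations compose from left to right. *)
Lemma matched_mul s t p q :
  matched s p -> matched t q -> matched (t * s) (p * q).
Proof.
move=> sp tq i; rewrite permM same_block_mul.
exact: connect_trans (stack_top q (sp (t i))) (stack_bottom p (tq i)).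
Qed.

Definition to_top s (x : 'I_k + 'I_k) := match x with inl i => i | inr i => s i end.

Lemma same_block_top s p x y : matched s p ->
  same_block p x y = top_rel p (to_top s x) (to_top s y).
Proof.
move=> sp; have [rp syp tp] := same_block_equiv p.
have leg z : same_block p (inl (to_top s z)) z by case: z => i /=.
apply/idP/idP => xy.
  by apply: (tp) (leg x) _; apply: (tp) xy _; rewrite syp.
by apply: (tp) (leg y); apply: (tp) xy; rewrite syp.
Qed.

Lemma ubp_eq s p q : matched s p -> matched s q -> top_rel p =2 top_rel q -> p = q.
Proof.
move=> sp sq pq; apply: val_inj.
apply: partition_ext => [||x y]; try exact: ubp_partition.
by rewrite !(same_block_top _ _ (s := s)).
Qed.

(* Along [p], the top points of [q] are identified with top points through    *)
(* [s], so that the top relation of the product is a join of conjugates.      *)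
Lemma top_rel_mul s p q : matched s p ->
  top_rel (p * q) =2 join_rel (top_rel p) (relpre s^-1 (top_rel q)).
Proof.
move=> sp i j; have [t tq] := exists_matched q.
rewrite /top_rel same_block_mul -/(top_rel p) -/(top_rel q) /=.
set R := join_rel _ _.
(* [h] sends each vertex of the stack to a top point of its component. *)
pose h (z : 'I_k + 'I_k + 'I_k) :=
  match z with inl (inl a) => a | inl (inr a) => s a | inr a => s (t a) end.
apply/idP/idP.
  suff key u v : connect (same_block (stack p q)) u v -> R (h u) (h v) by move/key.
  case/connectP=> l; elim: l u => [|w l IHl] u /=.
    by move=> _ ->; apply: connect0.
  case/andP=> uw pth /(IHl _ pth); apply: connect_trans.
  move: uw; rewrite same_block_stack => /orP[]/embedP[a [b [-> -> ab]]].
    have ht z : h (top_half z) = to_top s z by case: z.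
    by rewrite !ht; apply: join_rel_subl; rewrite -same_block_top.
  have hb z : h (bottom_half z) = s (to_top t z) by case: z.
  by rewrite !hb; apply: join_rel_subr; rewrite /= !permK -same_block_top.
have symS := @components_sym _ (stack p q).
(* Conversely, a step of the second relation is made by going down to the middle level, using a
   block of [q], and coming back. *)
have leg z : connect (same_block (stack p q)) (inl (inl z)) (inl (inr (s^-1 z))).
  by have := stack_top q (sp (s^-1 z)); rewrite permKV.
case/connectP=> l; elim: l i => [|w l IHl] u /=.
  by move=> _ ->; apply: connect0.
case/andP=> uw pth /(IHl _ pth); apply: connect_trans.
case/orP: uw => [uw|/= uw]; first exact: (stack_top q uw).
apply: connect_trans (leg u) _; rewrite symS.
by apply: connect_trans (leg w) _; rewrite symS; apply: (stack_bottom p uw).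
Qed.

(** The permutation contributes only equality to the join. *)
Lemma top_rel_perml s q : top_rel (ubp_perm s * q) =2 relpre s^-1 (top_rel q).
Proof.
move=> i j; rewrite (top_rel_mul _ (@matched_perm s)).
have eqq := equiv_rel_preim s^-1 (top_rel_equiv q); have [rq _ _] := eqq.
apply/idP/idP; last by move=> ij; apply: join_rel_subr.
by apply: join_rel_min => // x y; rewrite top_rel_perm => /eqP->.
Qed.

Lemma top_rel_permr p s : top_rel (p * ubp_perm s) =2 top_rel p.
Proof.
have [t tp] := exists_matched p.
move=> i j; rewrite (top_rel_mul _ tp).
apply/idP/idP; last by move=> ij; apply: join_rel_subl.
have [rp syp trp] := top_rel_equiv p.
apply: join_rel_min => // x y /=; rewrite top_rel_perm.
by move/eqP/perm_inj->; apply: rp.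
Qed.

Lemma ubp_perm1 : ubp_perm 1 = 1 :> ubp k. Proof. by []. Qed.

(** * The closed family attached to a submonoid *)

Definition tops (S : {set ubp k}) (E : rel 'I_k) :=
  exists2 p, p \in S & top_rel p =2 E.

Variable S : {set ubp k}.
Hypotheses (monS : monoid_closed S) (symS : ubp_sym k \subset S).

Lemma perm_in s : ubp_perm s \in S.
Proof. by apply: (subsetP symS); apply: imset_f. Qed.

Lemma mul_in p q : p \in S -> q \in S -> p * q \in S.
Proof. by case: monS => _; apply. Qed.

Lemma tops_closed : conj_join_closed (tops S).
Proof.
split=> [E F EF|E s|E F].
- by case=> p pS pE; exists p => // x y; rewrite pE EF.
- case=> p pS pE; exists (ubp_perm s^-1 * p); first exact: mul_in (perm_in _) pS.
  by move=> i j; rewrite top_rel_perml /= invgK pE.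
- case=> p pS pE [q qS qF]; have [s sp] := exists_matched p.
  (* The inserted permutation cancels the conjugation by [s^-1] that the product introduces. *)
  exists (p * (ubp_perm s^-1 * q)).
    exact: mul_in pS (mul_in (perm_in _) qS).
  move=> i j; rewrite (top_rel_mul _ sp); apply: eq_connect => x y /=.
  by rewrite pE top_rel_perml /= invgK !permKV qF.
Qed.

(** Equal top relations leave only the matchings to adjust: the right factor [t * s^-1] turns the
    matching [s] of [q] into [t]. *)
Lemma mem_tops p : tops S (top_rel p) -> p \in S.
Proof.
case=> q qS qp.
have [s sq] := exists_matched q; have [t tp] := exists_matched p.
rewrite (_ : p = q * ubp_perm (t * s^-1)); first exact: mul_in qS (perm_in _).
apply: (ubp_eq tp); last by move=> i j; rewrite top_rel_permr qp.
by have := matched_mul sq (@matched_perm (t * s^-1)); rewrite mulgKV.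
Qed.

End Tops.

(** * Unions of submonoids containing the permutations *)

Section Overmonoids.

Variable k : nat.
Implicit Types S : {set ubp k}.

(** The top relation of [p * q] is a join of members of the two families, so it lies in one of them,
    and [mem_tops] brings [p * q] back to that submonoid. *)
Lemma mul_or S1 S2 p q :
  monoid_closed S1 -> ubp_sym k \subset S1 ->
  monoid_closed S2 -> ubp_sym k \subset S2 ->
  p \in S1 -> q \in S2 -> p * q \in S1 :|: S2.
Proof.
move=> mon1 sym1 mon2 sym2 pS qS; have [s sp] := exists_matched p.
have clos1 := tops_closed mon1 sym1; have clos2 := tops_closed mon2 sym2.
have eqq := equiv_rel_preim s^-1 (top_rel_equiv q).
have top1 : tops S1 (top_rel p) by exists p.
have top2 : tops S2 (relpre s^-1 (top_rel q)).
  by apply: (closed_conj clos2); exists q.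
have top_pq x y := esym (top_rel_mul q sp x y).
rewrite inE; have [] := closed_join_or clos1 clos2 (top_rel_equiv p) eqq top1 top2.
  by move/(closed_ext clos1 top_pq)/(mem_tops mon1 sym1)->.
by move/(closed_ext clos2 top_pq)/(mem_tops mon2 sym2)->; rewrite orbT.
Qed.

Lemma setU_monoid_closed S1 S2 :
  monoid_closed S1 -> ubp_sym k \subset S1 ->
  monoid_closed S2 -> ubp_sym k \subset S2 ->
  monoid_closed (S1 :|: S2).
Proof.
move=> mon1 sym1 mon2 sym2; have [one1 mul1] := mon1; have [_ mul2] := mon2.
split=> [|p q]; first by rewrite inE one1.
rewrite !inE => /orP[p1|p2] /orP[q1|q2].
- by rewrite mul1.
- by have := mul_or mon1 sym1 mon2 sym2 p1 q2; rewrite inE.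
- by have := mul_or mon2 sym2 mon1 sym1 p2 q1; rewrite inE orbC.
- by rewrite mul2 ?orbT.
Qed.

Definition overmonoid S :=
  (ubp_sym k \subset S) && [forall p in S, forall q in S, p * q \in S].

Lemma overmonoidP S :
  reflect (monoid_closed S /\ ubp_sym k \subset S) (overmonoid S).
Proof.
apply: (iffP andP) => [[symS mulS]|[[_ mulS] symS]]; split=> //.
  split=> [|p q pS qS]; last exact: (forall_inP (forall_inP mulS p pS)).
  by rewrite -ubp_perm1; apply: perm_in.
by apply/forall_inP => p pS; apply/forall_inP => q; apply: mulS.
Qed.

(** * The distributive lattice, with its laws inherited from sets *)

Record overmonoids := Overmonoid {
  overmonoid_set :> {set ubp k};
  overmonoid_setP : overmonoid overmonoid_set }.

HB.instance Definition _ := [isSub for overmonoid_set].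
HB.instance Definition _ := [Choice of overmonoids by <:].

Implicit Types A B D : overmonoids.

Lemma overmonoidU A B : overmonoid (A :|: B).
Proof.
have [[monA symA] [monB symB]] :=
  (overmonoidP _ (overmonoid_setP A), overmonoidP _ (overmonoid_setP B)).
apply/overmonoidP; split; first exact: setU_monoid_closed.
exact: subset_trans symA (subsetUl _ _).
Qed.

Lemma overmonoidI A B : overmonoid (A :&: B).
Proof.
have [[[oneA mulA] symA] [[oneB mulB] symB]] :=
  (overmonoidP _ (overmonoid_setP A), overmonoidP _ (overmonoid_setP B)).
apply/overmonoidP; split; last by rewrite subsetI symA.
split=> [|p q]; first by rewrite inE oneA.
by rewrite !inE => /andP[pA pB] /andP[qA qB]; rewrite mulA ?mulB.
Qed.

Definition over_le A B := A \subset B.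
Definition over_meet A B := Overmonoid (overmonoidI A B).
Definition over_join A B := Overmonoid (overmonoidU A B).

Lemma over_le_def A B : over_le A B = (over_meet A B == A).
Proof. by rewrite -val_eqE /=; apply/idP/eqP => /setIidPl. Qed.
Lemma over_meetC : commutative over_meet.
Proof. by move=> A B; apply: val_inj; apply: setIC. Qed.
Lemma over_joinC : commutative over_join.
Proof. by move=> A B; apply: val_inj; apply: setUC. Qed.
Lemma over_meetA : associative over_meet.
Proof. by move=> A B D; apply: val_inj; apply: setIA. Qed.
Lemma over_joinA : associative over_join.
Proof. by move=> A B D; apply: val_inj; apply: setUA. Qed.
Lemma over_joinKI B A : over_meet A (over_join A B) = A.
Proof. by apply: val_inj; rewrite /= setUC setKU. Qed.
Lemma over_meetKU B A : over_join A (over_meet A B) = A.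
Proof. by apply: val_inj; rewrite /= setIC setKI. Qed.
Lemma over_meetUl : left_distributive over_meet over_join.
Proof. by move=> A B D; apply: val_inj; apply: setIUl. Qed.
Lemma over_meetxx : idempotent_op over_meet.
Proof. by move=> A; apply: val_inj; apply: setIid. Qed.

HB.instance Definition _ := Order.isMeetJoinDistrLattice.Build
  Order.SetSubsetOrder.subset_display overmonoids
  over_le_def (fun _ _ => erefl) over_meetC over_joinC over_meetA over_joinA
  over_joinKI over_meetKU over_meetUl over_meetxx.

End Overmonoids.

Theorem theorem5p3 (k : nat) (k_gt0 : (0 < k)%N) :
  (forall S1 S2 : {set ubp k},
      monoid_closed S1 -> ubp_sym k \subset S1 ->
      monoid_closed S2 -> ubp_sym k \subset S2 ->
      monoid_closed (S1 :|: S2))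
  /\ (exists (d : Order.disp_t) (L : distrLatticeType d) (h : L -> {set ubp k}),
        [/\ injective h,
            forall S : {set ubp k},
              (exists x : L, h x = S) <-> (monoid_closed S /\ ubp_sym k \subset S),
            forall x y : L, h (Order.join x y) = h x :|: h y
          & forall x y : L, h (Order.meet x y) = h x :&: h y]).
Proof.
split; first exact: setU_monoid_closed.
exists _, (overmonoids k : distrLatticeType _), (@overmonoid_set k).
split=> // [|S]; first exact: val_inj.
split=> [[A <-]|/overmonoidP overS]; first exact/overmonoidP/overmonoid_setP.
by exists (Overmonoid overS).
Qed.
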